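(* Any symmetric bilinear form $\lambda$ has a universal symmetric quadratic refinement $\mu^c_\lambda$, i.e. $(\lambda,\mu^c_\lambda)$ is initial in the category of symmetric quadratic refinements of $\lambda$. In fact, the forgetful functor $R(\lambda,\mu)=\lambda$ from the category $\mathsf{SQF}$ of symmetric quadratic forms to the category $\mathsf{SF}$ of symmetric forms has a left adjoint $L:\mathsf{SF}\to\mathsf{SQF}$, $L(\lambda)=(\lambda,\mu^c_\lambda)$.
   Context: A symmetric quadratic group $\mathfrak M=(M_e\xrightarrow{h}M_{ee}\xrightarrow{p}M_e)$ consists of two abelian groups $M_e,M_{ee}$ and homomorphisms $h,p$ with $hp=2\,\mathrm{id}$ and $ph=2\,\mathrm{id}$. A morphism $\beta:\mathfrak M\to\mathfrak M'$ is a pair of homomorphisms $\beta_e:M_e\to M'_e$, $\beta_{ee}:M_{ee}\to M'_{ee}$ commuting with $h,h'$ and $p,p'$. A symmetric quadratic form $(\lambda,\mu):A\to\mathfrak M$ on an abelian group $A$ consists of a symmetric quadratic group $\mathfrak M$, a bilinear map $\lambda:A\times A\to M_{ee}$ and a map $\mu:A\to M_e$ with $\mu(a+a')=\mu(a)+\mu(a')+p(\lambda(a,a'))$ and $h(\mu(a))=\lambda(a,a)$ for all $a,a'\in A$. (It follows that $\lambda$ is symmetric and $\mu(-a)=\mu(a)$.) Morphisms in $\mathsf{SQF}$ are pairs $(\alpha:A\to A',\ \beta:\mathfrak M\to\mathfrak M')$ of morphisms with $\lambda'(\alpha a_1,\alpha a_2)=\beta_{ee}\lambda(a_1,a_2)$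 and $\mu'(\alpha a)=\beta_e\mu(a)$. A symmetric form is a bilinear map $\lambda:A\times A\to M$ of abelian groups with $\lambda(a',a)=\lambda(a,a')$ ($M$ carrying the trivial involution). Morphisms in $\mathsf{SF}$ are pairs of homomorphisms $(\alpha:A\to A',\ \beta_{ee}:M\to M')$ with $\lambda'(\alpha a_1,\alpha a_2)=\beta_{ee}\lambda(a_1,a_2)$. $R$ forgets $\mu$, $M_e$ and $\beta_e$. A symmetric quadratic refinement of $\lambda:A\times A\to M$ is a symmetric quadratic form $(\lambda,\mu):A\to\mathfrak M$ with $M_{ee}=M$; morphisms of such refinements are the morphisms in $\mathsf{SQF}$ lying over the identity of $\lambda$. *)

(* Defs.v *)
From HB Require Import structures.
From mathcomp Require Import all_boot all_algebra boolp.

Set Implicit Arguments.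
Unset Strict Implicit.
Unset Printing Implicit Defensive.

Import GRing.Theory.
Local Open Scope ring_scope.

(* Abelian groups are zmodTypes. The choice operator carried by a zmodType is
   ignored by {additive _ -> _} and, classically, exists on every type, so this
   is no restriction. *)

Record category := Category {
  obj :> Type;
  hom : obj -> obj -> Type;
  idc : forall x, hom x x;
  compc : forall x y z, hom y z -> hom x y -> hom x z;
  comp_idl : forall x y (f : hom x y), compc (idc y) f = f;
  comp_idr : forall x y (f : hom x y), compc f (idc x) = f;
  comp_assoc : forall x y z t (h : hom z t) (g : hom y z) (f : hom x y),
    compc h (compc g f) = compc (compc h g) f
}.

Record functor (C D : category) := Functor {
  fobj :> C -> D;
  fmap : forall x y, hom x y -> hom (fobj x) (fobj y);
  fmap_id : forall x, fmap (idc x) = idc (fobj x);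
  fmap_comp : forall x y z (g : hom y z) (f : hom x y),
    fmap (compc g f) = compc (fmap g) (fmap f)
}.

Definition initial (C : category) (x : C) : Prop :=
  forall y : C, exists f : hom x y, forall g : hom x y, g = f.

Definition left_adjoint (C D : category) (L : functor C D) (R : functor D C)
    : Prop :=
  exists phi : forall (x : C) (y : D), hom (L x) y -> hom x (R y),
    [/\ forall x y, bijective (@phi x y),
        forall (x x' : C) (y : D) (f : hom x' x) (g : hom (L x) y),
          phi x' y (compc g (fmap L f)) = compc (phi x y g) f
      & forall (x : C) (y y' : D) (f : hom y y') (g : hom (L x) y),
          phi x y' (compc f g) = compc (fmap R f) (phi x y g)].

Lemma additive_eq (U V : zmodType) (f g : {additive U -> V}) : f =1 g -> f = g.
Proof.
case: f g => [f [[cf]]] [g [[cg]]] /= /funext efg; subst g.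
by rewrite (Prop_irrelevance cf cg).
Qed.

Definition id_add (U : zmodType) : {additive U -> U} := idfun.

Definition comp_add (U V W : zmodType) (g : {additive V -> W})
  (f : {additive U -> V}) : {additive U -> W} := g \o f.

Definition bilin (A M : zmodType) (lam : A -> A -> M) : Prop :=
  (forall a, {morph lam a : b b' / b + b'}) /\
  (forall b, {morph lam^~ b : a a' / a + a'}).

Record symform := SymForm {
  sf_dom : zmodType;
  sf_cod : zmodType;
  sf_form : sf_dom -> sf_dom -> sf_cod;
  sf_bilin : bilin sf_form;
  sf_sym : forall a a', sf_form a' a = sf_form a a'
}.

Record symform_hom (S S' : symform) := SymFormHom {
  sfh_dom : {additive sf_dom S -> sf_dom S'};
  sfh_cod : {additive sf_cod S -> sf_cod S'};
  sfh_form : forall a1 a2,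
    sf_form (sfh_dom a1) (sfh_dom a2) = sfh_cod (sf_form a1 a2)
}.

Lemma symform_hom_eq S S' (f g : symform_hom S S') :
  sfh_dom f =1 sfh_dom g -> sfh_cod f =1 sfh_cod g -> f = g.
Proof.
case: f g => [f1 f2 f3] [g1 g2 g3] /= /additive_eq e1 /additive_eq e2.
by subst g1 g2; rewrite (Prop_irrelevance f3 g3).
Qed.

Definition symform_id S : symform_hom S S :=
  @SymFormHom S S (id_add _) (id_add _) (fun _ _ => erefl).

Lemma symform_comp_subproof S1 S2 S3 (g : symform_hom S2 S3)
    (f : symform_hom S1 S2) a1 a2 :
  sf_form (comp_add (sfh_dom g) (sfh_dom f) a1)
          (comp_add (sfh_dom g) (sfh_dom f) a2)
  = comp_add (sfh_cod g) (sfh_cod f) (sf_form a1 a2).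
Proof. by rewrite /= !sfh_form. Qed.

Definition symform_comp S1 S2 S3 (g : symform_hom S2 S3)
    (f : symform_hom S1 S2) : symform_hom S1 S3 :=
  SymFormHom (symform_comp_subproof g f).

Definition SF : category.
Proof.
by refine (@Category symform symform_hom symform_id symform_comp _ _ _) => *;
   apply: symform_hom_eq.
Defined.

Record sqgroup := SQGroup {
  sq_e : zmodType;
  sq_ee : zmodType;
  sq_h : {additive sq_e -> sq_ee};
  sq_p : {additive sq_ee -> sq_e};
  sq_hp : forall x, sq_h (sq_p x) = x *+ 2;
  sq_ph : forall x, sq_p (sq_h x) = x *+ 2
}.

Record sqgroup_hom (G G' : sqgroup) := SQGroupHom {
  sqh_e : {additive sq_e G -> sq_e G'};
  sqh_ee : {additive sq_ee G -> sq_ee G'};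
  sqh_h : forall x, sq_h G' (sqh_e x) = sqh_ee (sq_h G x);
  sqh_p : forall x, sq_p G' (sqh_ee x) = sqh_e (sq_p G x)
}.

Lemma sqgroup_hom_eq G G' (f g : sqgroup_hom G G') :
  sqh_e f =1 sqh_e g -> sqh_ee f =1 sqh_ee g -> f = g.
Proof.
case: f g => [f1 f2 f3 f4] [g1 g2 g3 g4] /= /additive_eq e1 /additive_eq e2.
by subst g1 g2; rewrite (Prop_irrelevance f3 g3) (Prop_irrelevance f4 g4).
Qed.

Definition sqgroup_id G : sqgroup_hom G G :=
  @SQGroupHom G G (id_add _) (id_add _) (fun _ => erefl) (fun _ => erefl).

Definition sqgroup_comp G1 G2 G3 (g : sqgroup_hom G2 G3)
  (f : sqgroup_hom G1 G2) : sqgroup_hom G1 G3.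
Proof.
by refine (@SQGroupHom G1 G3 (comp_add (sqh_e g) (sqh_e f))
             (comp_add (sqh_ee g) (sqh_ee f)) _ _) => x;
   rewrite /= ?sqh_h ?sqh_p.
Defined.

Record sqform := SQForm {
  qf_dom : zmodType;
  qf_group : sqgroup;
  qf_lam : qf_dom -> qf_dom -> sq_ee qf_group;
  qf_mu : qf_dom -> sq_e qf_group;
  qf_bilin : bilin qf_lam;
  qf_muD : forall a a',
    qf_mu (a + a') = qf_mu a + qf_mu a' + sq_p qf_group (qf_lam a a');
  qf_hmu : forall a, sq_h qf_group (qf_mu a) = qf_lam a a
}.

Record sqform_hom (Q Q' : sqform) := SQFormHom {
  qfh_dom : {additive qf_dom Q -> qf_dom Q'};
  qfh_group : sqgroup_hom (qf_group Q) (qf_group Q');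
  qfh_lam : forall a1 a2,
    qf_lam (qfh_dom a1) (qfh_dom a2) = sqh_ee qfh_group (qf_lam a1 a2);
  qfh_mu : forall a, qf_mu (qfh_dom a) = sqh_e qfh_group (qf_mu a)
}.

Lemma sqform_hom_eq Q Q' (f g : sqform_hom Q Q') :
  qfh_dom f =1 qfh_dom g -> qfh_group f = qfh_group g -> f = g.
Proof.
case: f g => [f1 f2 f3 f4] [g1 g2 g3 g4] /= /additive_eq e1 e2.
by subst g1 g2; rewrite (Prop_irrelevance f3 g3) (Prop_irrelevance f4 g4).
Qed.

Definition sqform_id Q : sqform_hom Q Q :=
  @SQFormHom Q Q (id_add _) (sqgroup_id _) (fun _ _ => erefl) (fun _ => erefl).

Definition sqform_comp Q1 Q2 Q3 (g : sqform_hom Q2 Q3)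
  (f : sqform_hom Q1 Q2) : sqform_hom Q1 Q3.
Proof.
by refine (@SQFormHom Q1 Q3 (comp_add (qfh_dom g) (qfh_dom f))
             (sqgroup_comp (qfh_group g) (qfh_group f)) _ _) => *;
   rewrite /= ?qfh_lam ?qfh_mu.
Defined.

Definition SQF : category.
Proof.
by refine (@Category sqform sqform_hom sqform_id sqform_comp _ _ _) => *;
   apply: sqform_hom_eq => //; apply: sqgroup_hom_eq.
Defined.

Lemma qf_lam_sym Q (a a' : qf_dom Q) : qf_lam a' a = qf_lam a a'.
Proof.
have [lamr laml] := qf_bilin Q.
have := qf_hmu (a + a').
rewrite qf_muD !raddfD /= !qf_hmu sq_hp laml !lamr mulr2n => /eqP.
set x := qf_lam a a; set y := qf_lam a' a'; set u := qf_lam a a'.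
set v := qf_lam a' a.
rewrite -!addrA (inj_eq (addrI x)) [y + _]addrC -!addrA (inj_eq (addrI u)).
by rewrite (inj_eq (addIr y)) => /eqP ->.
Qed.

Definition forget_obj (Q : sqform) : symform :=
  SymForm (qf_bilin Q) (@qf_lam_sym Q).

Definition forget_hom Q Q' (f : sqform_hom Q Q')
    : symform_hom (forget_obj Q) (forget_obj Q') :=
  @SymFormHom (forget_obj Q) (forget_obj Q')
    (qfh_dom f) (sqh_ee (qfh_group f)) (qfh_lam f).

Definition forget : functor SQF SF.
Proof.
by refine (@Functor SQF SF forget_obj forget_hom _ _) => *;
   apply: symform_hom_eq.
Defined.

(* A refinement keeps lambda and takes M_ee to be the codomain of lambda on the
   nose; only M_e, h, p and mu are additional data. *)
Record refinement (S : symform) := Refinement {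
  rf_e : zmodType;
  rf_h : {additive rf_e -> sf_cod S};
  rf_p : {additive sf_cod S -> rf_e};
  rf_hp : forall x, rf_h (rf_p x) = x *+ 2;
  rf_ph : forall x, rf_p (rf_h x) = x *+ 2;
  rf_mu : sf_dom S -> rf_e;
  rf_muD : forall a a', rf_mu (a + a') = rf_mu a + rf_mu a' + rf_p (sf_form a a');
  rf_hmu : forall a, rf_h (rf_mu a) = sf_form a a
}.

Definition refined_form S (r : refinement S) : sqform :=
  @SQForm (sf_dom S) (SQGroup (@rf_hp S r) (@rf_ph S r)) (@sf_form S)
    (@rf_mu S r) (sf_bilin S) (@rf_muD S r) (@rf_hmu S r).

(* forget_obj (refined_form r) and S have the same carriers and the same form
   definitionally, but not the same symmetry proof; hence the identity of S is
   spelled out on its two components. *)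
Definition over_id S (r r' : refinement S)
    (f : sqform_hom (refined_form r) (refined_form r')) : Prop :=
  (forall a : sf_dom S, sfh_dom (forget_hom f) a = a) /\
  (forall x : sf_cod S, sfh_cod (forget_hom f) x = x).

Record refinement_hom S (r r' : refinement S) := RefinementHom {
  rfh_hom : sqform_hom (refined_form r) (refined_form r');
  rfh_over : over_id rfh_hom
}.

Lemma refinement_hom_eq S (r r' : refinement S) (f g : refinement_hom r r') :
  rfh_hom f = rfh_hom g -> f = g.
Proof.
case: f g => [f1 f2] [g1 g2] /= e1.
by subst g1; rewrite (Prop_irrelevance f2 g2).
Qed.

Definition refinement_id S (r : refinement S) : refinement_hom r r :=
  @RefinementHom S r r (sqform_id _) (conj (fun _ => erefl) (fun _ => erefl)).

Definition refinement_comp S (r1 r2 r3 : refinement S)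
  (g : refinement_hom r2 r3) (f : refinement_hom r1 r2) : refinement_hom r1 r3.
Proof.
refine (@RefinementHom S r1 r3 (sqform_comp (rfh_hom g) (rfh_hom f)) _).
have [f1 f2] := rfh_over f; have [g1 g2] := rfh_over g.
by split=> x; [exact: etrans (g1 _) (f1 x) | exact: etrans (g2 _) (f2 x)].
Defined.

Definition refinements (S : symform) : category.
Proof.
by refine (@Category (refinement S) (@refinement_hom S) (@refinement_id S)
             (@refinement_comp S) _ _ _) => *;
   apply: refinement_hom_eq;
   apply: sqform_hom_eq => //; apply: sqgroup_hom_eq.
Defined.

(* Main.v *)
From HB Require Import structures.
From mathcomp Require Import all_boot all_algebra boolp.
Require Import Defs.

(** The group M_e of the universal refinement of lambda : A x A -> M has to be
the abelian group with generators mu(a), for a in A, and p(m), for m in M,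
subject to additivity of p, to mu(a + a') = mu(a) + mu(a') + p(lambda(a, a')),
and to p h = 2; the map h is then forced by h(mu(a)) = lambda(a, a) and
h(p(m)) = 2m, so that p h = 2 amounts to p(lambda(a, a)) = 2 mu(a), the
relation p(h(p(m))) = 2 p(m) being automatic.

Instead of working with a presentation one can write this group down. Without
the last relation, every element is p(m) + mu(a) for a unique pair (m, a), and
the group is M x A with addition twisted by the symmetric 2-cocycle - lambda;
this is [cocycle_ext]. In it the differences
2 mu(a) - p(lambda(a, a)) = (- 2 lambda(a, a), 2a) depend additively on a,
because lambda is bilinear. They therefore form a subgroup ([mu_relation]), and
M_e is the quotient by it.

A morphism from (lambda, mu^c) to a symmetric quadratic form (lambda', mu')
over a given morphism (alpha, beta_ee) of symmetric forms must send
p(m) + mu(a) to p'(beta_ee(m)) + mu'(alpha(a)), and this formula does define a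
morphism ([universal_refinement_universal]). So the identity of lambda is a
universal arrow from lambda to the forgetful functor. Universal arrows at all
objects assemble into a left adjoint ([left_adjoint_of_universal]), and the
same universal property, read for the morphisms over the identity of lambda,
says that the refinement is initial ([initial_of_universal]). *)

Set Implicit Arguments.
Unset Strict Implicit.
Unset Printing Implicit Defensive.

Import GRing.Theory.
Local Open Scope ring_scope.
Local Open Scope quotient_scope.

(** * Universal arrows and adjoints *)

Definition universal_arrow (C D : category) (R : functor D C) (x : C) (u : D)
    (eta : hom x (R u)) : Prop :=
  forall (y : D) (f : hom x (R y)), exists! g : hom u y, compc (fmap R g) eta = f.

(** The object part of the adjoint is prescribed on the nose, so that it can be
    chosen as a refinement of the given form. *)
Lemma left_adjoint_of_universal (C D : category) (R : functor D C)
    (F : C -> D) (eta : forall x, hom x (R (F x))) :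
    (forall x, universal_arrow (eta x)) ->
  exists L : functor C D, (forall x, L x = F x) /\ left_adjoint L R.
Proof.
move=> univ.
pose ext x y (f : hom x (R y)) : hom (F x) y := sval (cid (univ x y f)).
have extK x y (f : hom x (R y)) : compc (fmap R (ext x y f)) (eta x) = f.
  by rewrite /ext; case: cid => g [].
have ext_uniq x y (g : hom (F x) y) : ext x y (compc (fmap R g) (eta x)) = g.
  by rewrite /ext; case: cid => g' /= [_ uniq]; apply: uniq.
pose Fmap x y (f : hom x y) := ext x (F y) (compc (eta y) f).
have Fmap_id x : Fmap x x (idc x) = idc (F x).
  by rewrite /Fmap comp_idr -[eta x]comp_idl -fmap_id ext_uniq.
have Fmap_comp x y z (g : hom y z) (f : hom x y) :
    Fmap x z (compc g f) = compc (Fmap y z g) (Fmap x y f).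
  rewrite -[RHS]ext_uniq fmap_comp -comp_assoc extK.
  by rewrite [compc _ (compc _ _)]comp_assoc extK -comp_assoc.
exists (Functor Fmap_id Fmap_comp); split=> //=.
exists (fun x y (g : hom (F x) y) => compc (fmap R g) (eta x)); split.
- by move=> x y; exists (ext x y) => g; [apply: ext_uniq | apply: extK].
- move=> x x' y f g /=.
  by rewrite fmap_comp -comp_assoc extK comp_assoc.
- by move=> x y y' f g; rewrite fmap_comp comp_assoc.
Qed.

(** * Quotients of abelian groups *)

(** Stated with a sigma-type rather than an existential, because the map h of
    the universal refinement is data. *)
Lemma quot_factor (V W : zmodType) (I : zmodClosed V) (f : {additive V -> W}) :
    (forall x, x \in I -> f x = 0) ->
  {g : {additive Quotient.quot I -> W} |
    forall x, g (\pi_(Quotient.quot I) x) = f x}.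
Proof.
move=> fI; pose g (x : Quotient.quot I) := f (repr x).
have gE x : g (\pi_(Quotient.quot I) x) = f x.
  apply/eqP; rewrite -subr_eq0 -raddfB fI //.
  by rewrite Quotient.idealrBE reprK.
have g_additive : zmod_morphism g.
  by elim/quotW => x; elim/quotW => y; rewrite -raddfB !gE raddfB.
pose gM := GRing.isZmodMorphism.Build _ _ g g_additive.
by exists (HB.pack_for {additive Quotient.quot I -> W} g gM).
Qed.

(** * The extension of A by M with cocycle - lambda *)

Section FormTheory.
Variable S : symform.
Local Notation lam := (@sf_form S).

Lemma sf_formDl a b c : lam (a + b) c = lam a c + lam b c.
Proof. exact: (sf_bilin S).2. Qed.

Lemma sf_formDr a b c : lam a (b + c) = lam a b + lam a c.
Proof. exact: (sf_bilin S).1. Qed.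

Lemma sf_form0r a : lam a 0 = 0.
Proof. by apply: (addrI (lam a 0)); rewrite -sf_formDr !addr0. Qed.

Lemma sf_formNr a b : lam a (- b) = - lam a b.
Proof. by apply: (addrI (lam a b)); rewrite -sf_formDr !subrr sf_form0r. Qed.

Lemma sf_formNl a b : lam (- a) b = - lam a b.
Proof. by rewrite sf_sym sf_formNr sf_sym. Qed.

Lemma sf_form_diagD a b :
  lam (a + b) (a + b) = lam a a + lam b b + lam a b *+ 2.
Proof.
rewrite sf_formDl !sf_formDr (sf_sym a b) mulr2n.
by rewrite (AC (2*2) ((1*4)*(2*3))).
Qed.

End FormTheory.

(** The pair (m, a) stands for p(m) + mu(a); the addition below is read off from
    mu(a) + mu(b) = mu(a + b) - p(lambda(a, b)). *)
Definition cocycle_ext (S : symform) : Type := (sf_cod S * sf_dom S)%type.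

HB.instance Definition _ (S : symform) :=
  Choice.copy (cocycle_ext S) (sf_cod S * sf_dom S)%type.

Section CocycleExt.
Variable S : symform.
Local Notation lam := (@sf_form S).
Implicit Types x y z : cocycle_ext S.

Definition ext_add x y : cocycle_ext S :=
  (x.1 + y.1 - lam x.2 y.2, x.2 + y.2).
Definition ext_opp x : cocycle_ext S := (- x.1 - lam x.2 x.2, - x.2).
Definition ext_zero : cocycle_ext S := (0, 0).

Lemma ext_addA : associative ext_add.
Proof.
move=> [m a] [n b] [k c]; rewrite /ext_add /= sf_formDl sf_formDr !opprD.
congr (_, _); last exact: addrA.
by rewrite (AC ((1*3)*2) ((1*2*5*3)*(6*4))).
Qed.

Lemma ext_addC : commutative ext_add.
Proof.
by move=> x y; rewrite /ext_add sf_sym [x.1 + _]addrC [x.2 + _]addrC.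
Qed.

Lemma ext_add0 : left_id ext_zero ext_add.
Proof.
by move=> [m a]; rewrite /ext_add /= sf_sym sf_form0r subr0 !add0r.
Qed.

Lemma ext_addN : left_inverse ext_zero ext_opp ext_add.
Proof.
move=> [m a]; rewrite /ext_add /ext_opp /= sf_formNl opprK addNr.
by rewrite addrAC subrK addNr.
Qed.

End CocycleExt.

HB.instance Definition _ (S : symform) :=
  GRing.isZmodule.Build (cocycle_ext S)
    (@ext_addA S) (@ext_addC S) (@ext_add0 S) (@ext_addN S).

(** * The universal refinement *)

Section UniversalRefinement.
Variable S : symform.
Local Notation lam := (@sf_form S).

Definition ext_p (m : sf_cod S) : cocycle_ext S := (m, 0).
Definition ext_mu (a : sf_dom S) : cocycle_ext S := (0, a).
(** The values h(p(m)) = 2m and h(mu(a)) = lambda(a, a) are forced. *)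
Definition ext_h (x : cocycle_ext S) : sf_cod S := x.1 *+ 2 + lam x.2 x.2.

Lemma ext_addE (m n : sf_cod S) (a b : sf_dom S) :
  ((m, a) : cocycle_ext S) + ((n, b) : cocycle_ext S) =
  (m + n - lam a b, a + b).
Proof. by []. Qed.

Lemma ext_decomp (x : cocycle_ext S) : x = ext_p x.1 + ext_mu x.2.
Proof.
by case: x => m a; rewrite ext_addE sf_sym sf_form0r subr0 addr0 add0r.
Qed.

Lemma ext_p_additive : nmod_morphism ext_p.
Proof. by split=> // m n; rewrite ext_addE sf_form0r subr0 addr0. Qed.

HB.instance Definition _ :=
  GRing.isNmodMorphism.Build (sf_cod S) (cocycle_ext S) ext_p ext_p_additive.

Lemma ext_muD a b : ext_mu (a + b) = ext_mu a + ext_mu b + ext_p (lam a b).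
Proof.
by rewrite !ext_addE sf_form0r subr0 !addr0 add0r addNr.
Qed.

Lemma ext_h_additive : nmod_morphism ext_h.
Proof.
split=> [|[m a] [n b]]; first by rewrite /ext_h sf_form0r mul0rn addr0.
rewrite ext_addE /ext_h /= sf_form_diagD mulrnDl mulNrn mulrnDl.
rewrite [lam a a + _ + _]addrC addrA subrK.
by rewrite addrACA.
Qed.

HB.instance Definition _ :=
  GRing.isNmodMorphism.Build (cocycle_ext S) (sf_cod S) ext_h ext_h_additive.

Lemma ext_hp m : ext_h (ext_p m) = m *+ 2.
Proof. by rewrite /ext_h /= sf_form0r addr0. Qed.

Lemma ext_hmu a : ext_h (ext_mu a) = lam a a.
Proof. by rewrite /ext_h /= mul0rn add0r. Qed.

Definition mu_defect (a : sf_dom S) : cocycle_ext S :=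
  ext_mu a *+ 2 - ext_p (lam a a).

(** Neither 2 mu(a) nor p(lambda(a, a)) is additive in a, but passing from a
    and b to a + b creates the same cross term 2 p(lambda(a, b)) in both, and it
    cancels. So the values of [mu_defect] form a subgroup. *)
Lemma mu_defect_additive : nmod_morphism mu_defect.
Proof.
split=> [|a b]; rewrite /mu_defect.
  by rewrite sf_form0r raddf0 addr0; apply: mul0rn.
(* A third use of additivity would split the double x *+ 2, which is x + x by
   conversion. *)
rewrite ext_muD sf_form_diagD 2!(raddfD ext_p) raddfMn 2!mulrnDl.
by rewrite opprD addrACA subrr addr0 opprD addrACA.
Qed.

HB.instance Definition _ :=
  GRing.isNmodMorphism.Build (sf_dom S) (cocycle_ext S) mu_defect
    mu_defect_additive.

Definition mu_relation : {pred cocycle_ext S} := fun x =>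
  `[< exists a, x = mu_defect a >].

Lemma mu_relation_closed : zmod_closed mu_relation.
Proof.
split=> [|x y /asboolP[a ->] /asboolP[b ->]]; apply/asboolP.
  by exists 0; rewrite (raddf0 mu_defect).
by exists (a - b); rewrite (raddfB mu_defect).
Qed.

HB.instance Definition _ :=
  GRing.isZmodClosed.Build (cocycle_ext S) mu_relation mu_relation_closed.

Definition univ_e : zmodType := Quotient.quot mu_relation.

Definition univ_pi : {additive cocycle_ext S -> univ_e} :=
  \pi_(Quotient.quot mu_relation).

Lemma univ_pi_defect a : univ_pi (ext_mu a *+ 2) = univ_pi (ext_p (lam a a)).
Proof.
apply/eqP; rewrite -Quotient.idealrBE; apply/asboolP.
by exists a.
Qed.

Lemma univ_factor (W : zmodType) (f : {additive cocycle_ext S -> W}) :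
    (forall a, f (mu_defect a) = 0) ->
  {g : {additive univ_e -> W} | forall x, g (univ_pi x) = f x}.
Proof. by move=> f0; apply: quot_factor => x /asboolP[a ->]. Qed.

Lemma ext_h_defect a : ext_h (mu_defect a) = 0.
Proof. by rewrite raddfB raddfMn /= ext_hmu ext_hp subrr. Qed.

Definition univ_h : {additive univ_e -> sf_cod S} :=
  sval (univ_factor ext_h_defect).

Lemma univ_h_pi x : univ_h (univ_pi x) = ext_h x.
Proof. exact: (svalP (univ_factor ext_h_defect)). Qed.

Definition univ_p : {additive sf_cod S -> univ_e} := univ_pi \o ext_p.

Definition univ_mu (a : sf_dom S) : univ_e := univ_pi (ext_mu a).

Lemma univ_ind (P : univ_e -> Prop) :
  (forall m a, P (univ_p m + univ_mu a)) -> forall x, P x.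
Proof.
move=> Ppm; elim/quotW => x.
rewrite (ext_decomp x) -[\pi__ _]/(univ_pi _) raddfD; exact: Ppm.
Qed.

Lemma univ_hp m : univ_h (univ_p m) = m *+ 2.
Proof. by rewrite univ_h_pi ext_hp. Qed.

Lemma univ_hmu a : univ_h (univ_mu a) = lam a a.
Proof. by rewrite univ_h_pi ext_hmu. Qed.

(** On p(m) this follows from h p = 2; on mu(a) it is exactly the relation
    imposed by the quotient. *)
Lemma univ_ph x : univ_p (univ_h x) = x *+ 2.
Proof.
elim/univ_ind: x => m a.
rewrite raddfD univ_hp univ_hmu raddfD raddfMn mulrnDl.
by congr (_ + _); rewrite -raddfMn univ_pi_defect.
Qed.

Lemma univ_muD a b : univ_mu (a + b) = univ_mu a + univ_mu b + univ_p (lam a b).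
Proof. by rewrite /univ_mu ext_muD !raddfD. Qed.

Definition universal_refinement : refinement S :=
  Refinement univ_hp univ_ph univ_muD univ_hmu.

End UniversalRefinement.

(** * The universal property *)

Section UniversalProperty.
Variable S : symform.

(** The identity of lambda, for an arbitrary refinement. It is not literally an
    identity morphism of SF, since forgetting a refinement of S returns S with
    another proof of symmetry. *)
Definition refinement_unit (r : refinement S) :
    symform_hom S (forget_obj (refined_form r)) :=
  @SymFormHom S (forget_obj (refined_form r)) (id_add _) (id_add _)
    (fun _ _ => erefl).

(** A morphism of forms lies over the identity of lambda exactly when it carries
    the unit of one refinement to the unit of the other; universality gives one
    such morphism to each refinement and no more. *)
Lemma initial_of_universal (r : refinement S) :
    @universal_arrow SF SQF forget S (refined_form r) (refinement_unit r) ->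
  @initial (refinements S) r.
Proof.
move=> univ r'.
have [g [gE g_uniq]] := univ (refined_form r') (refinement_unit r').
have over_idP (f : sqform_hom (refined_form r) (refined_form r')) :
    over_id f <->
    symform_comp (forget_hom f) (refinement_unit r) = refinement_unit r'.
  split=> [[fa fm]|fE]; first exact: symform_hom_eq.
  split=> x.
    exact: (congr1 (fun u => sfh_dom u x) fE).
  exact: (congr1 (fun u => sfh_cod u x) fE).
exists (RefinementHom ((over_idP g).2 gE)) => -[f f_over].
by apply: refinement_hom_eq; rewrite /= (g_uniq f) //; apply/over_idP.
Qed.

Variables (Q : sqform) (f : symform_hom S (forget_obj Q)).
Local Notation lam := (@sf_form S).
Local Notation p' := (sq_p (qf_group Q)).
Local Notation h' := (sq_h (qf_group Q)).
Local Notation mu' := (@qf_mu Q).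

Lemma qf_mu0 : mu' 0 = 0.
Proof.
have lam00 : @qf_lam Q 0 0 = 0 := @sf_form0r (forget_obj Q) 0.
apply: (addrI (mu' 0)); rewrite addr0 -[RHS]/(mu' 0).
by rewrite -{3}[0]addr0 qf_muD lam00 raddf0 addr0.
Qed.

Definition ext_extend (x : cocycle_ext S) : sq_e (qf_group Q) :=
  p' (sfh_cod f x.1) + mu' (sfh_dom f x.2).

Lemma ext_extend_additive : nmod_morphism ext_extend.
Proof.
split=> [|[m a] [n b]]; rewrite /ext_extend.
  by rewrite /= !raddf0 qf_mu0 addr0.
rewrite ext_addE /= !raddfB !raddfD /= qf_muD.
have -> : qf_lam (sfh_dom f a) (sfh_dom f b) = sfh_cod f (lam a b).
  exact: (sfh_form f a b).
by rewrite addrACA addNr addr0 addrACA.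
Qed.

HB.instance Definition _ :=
  GRing.isNmodMorphism.Build (cocycle_ext S) (sq_e (qf_group Q)) ext_extend
    ext_extend_additive.

Lemma ext_extend_p m : ext_extend (ext_p m) = p' (sfh_cod f m).
Proof. by rewrite /ext_extend /= raddf0 qf_mu0 addr0. Qed.

Lemma ext_extend_mu a : ext_extend (ext_mu a) = mu' (sfh_dom f a).
Proof. by rewrite /ext_extend /= !raddf0 add0r. Qed.

(** The relation 2 mu(a) = p(lambda(a, a)) is p h = 2 applied to mu(a), hence
    it holds in every symmetric quadratic form. *)
Lemma ext_extend_defect a : ext_extend (mu_defect a) = 0.
Proof.
rewrite raddfB raddfMn /= ext_extend_mu ext_extend_p.
have <- : qf_lam (sfh_dom f a) (sfh_dom f a) = sfh_cod f (lam a a).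
  exact: (sfh_form f a a).
by rewrite -qf_hmu sq_ph subrr.
Qed.

Definition univ_extend : {additive univ_e S -> sq_e (qf_group Q)} :=
  sval (univ_factor ext_extend_defect).

Lemma univ_extend_p m : univ_extend (univ_p S m) = p' (sfh_cod f m).
Proof.
exact: etrans (svalP (univ_factor ext_extend_defect) _) (ext_extend_p m).
Qed.

Lemma univ_extend_mu a : univ_extend (univ_mu a) = mu' (sfh_dom f a).
Proof.
exact: etrans (svalP (univ_factor ext_extend_defect) _) (ext_extend_mu a).
Qed.

Lemma univ_extend_h x : h' (univ_extend x) = sfh_cod f (univ_h S x).
Proof.
elim/univ_ind: x => m a.
rewrite !raddfD univ_extend_p univ_extend_mu sq_hp qf_hmu univ_hp univ_hmu.
by rewrite raddfMn; congr (_ + _); apply: (sfh_form f).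
Qed.

Definition univ_extend_group :
    sqgroup_hom (qf_group (refined_form (universal_refinement S))) (qf_group Q) :=
  @SQGroupHom (qf_group (refined_form (universal_refinement S))) (qf_group Q)
    univ_extend (sfh_cod f) univ_extend_h (fun m => esym (univ_extend_p m)).

Definition univ_extend_form :
    sqform_hom (refined_form (universal_refinement S)) Q :=
  @SQFormHom (refined_form (universal_refinement S)) Q
    (sfh_dom f) univ_extend_group (sfh_form f)
    (fun a => esym (univ_extend_mu a)).

End UniversalProperty.

(** Uniqueness holds because [univ_e] is generated by the p(m) and the mu(a), on
    which a morphism of symmetric quadratic forms is determined by its image in
    SF. *)
Lemma universal_refinement_universal (S : symform) :
  @universal_arrow SF SQF forget S (refined_form (universal_refinement S))
    (refinement_unit (universal_refinement S)).
Proof.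
move=> Q f; exists (univ_extend_form f); split; first exact: symform_hom_eq.
move=> g gE; apply: sqform_hom_eq => /= [a|].
  by rewrite -gE.
apply: sqgroup_hom_eq => /= [x|m]; last by rewrite -gE.
elim/univ_ind: x => m a; rewrite !raddfD univ_extend_p univ_extend_mu.
rewrite -gE /=; congr (_ + _).
  exact: (sqh_p (qfh_group g) m).
exact: (qfh_mu g a).
Qed.

Theorem theorem39 :
  exists muc : forall S : SF, refinements S,
    (forall S : SF, initial (muc S)) /\
    exists L : functor SF SQF,
      (forall S : SF, L S = refined_form (muc S)) /\ left_adjoint L forget.
Proof.
exists universal_refinement; split=> [S|].
  exact: initial_of_universal (@universal_refinement_universal S).
exact: (@left_adjoint_of_universal SF SQF forget
  (fun S => refined_form (universal_refinement S)) _
  universal_refinement_universal).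
Qed.
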